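(* Let $\beta\ge5$, $\epsilon_1\in\{0,1\}$ and $\epsilon_2\in\{1,-1\}$. There is no tight chiral $4$-polytope of type $\{2^{\beta-2},2^{\beta-1},2^\beta\}$ whose standard generators satisfy $\sigma_2\sigma_1^{-1}=\sigma_1\sigma_2^{3-\epsilon_12^{\beta-2}}$, $\sigma_3^{-1}\sigma_2=\sigma_2^{-1+2^{\beta-2}}\sigma_3^{-3+\epsilon_22^{\beta-2}}$ and $\sigma_3\sigma_2^{-1}=\sigma_2^{1+2^{\beta-2}}\sigma_3^{3+\epsilon_22^{\beta-2}}$.
   Context: For a chiral polytope with base flag $\Phi$, the standard generators $\sigma_1,\sigma_2,\sigma_3$ of its automorphism group are the automorphisms with $\Phi\sigma_i=\Phi^{i(i-1)}$, where $\Phi^j$ is the flag differing from $\Phi$ only in its $j$-face; for type $\{p,q,r\}$ they have orders $p,q,r$ and satisfy $(\sigma_1\sigma_2)^2=(\sigma_2\sigma_3)^2=(\sigma_1\sigma_2\sigma_3)^2=1$. Tight: type $\{p,q,r\}$ with exactly $2pqr$ flags. *)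

(* Defs.v *)
From HB Require Import structures.
From mathcomp Require Import all_boot all_order all_algebra all_fingroup.
Set Implicit Arguments. Unset Strict Implicit. Unset Printing Implicit Defensive.

(* Abstract polytopes of rank 4 on a finite set of faces T.
   [le] is the partial order, [rk] the rank function SHIFTED BY ONE:
   a face of (actual) rank i has [rk F = i + 1], so [rk] takes values 0..5
   (actual ranks -1..4).  A flag is a function Phi : 'I_6 -> T with
   Phi k the face of actual rank k-1, and Phi increasing. *)

Section Polytope.
Variables (T : finType) (le : rel T) (rk : T -> nat).

Definition ltf (x y : T) : bool := (x != y) && le x y.

Definition is_flag (f : {ffun 'I_6 -> T}) : bool :=
  [forall i : 'I_6, rk (f i) == i] &&
  [forall i : 'I_6, forall j : 'I_6, (i <= j)%N ==> le (f i) (f j)].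

Definition adjacent (f g : {ffun 'I_6 -> T}) : bool :=
  #|[set i : 'I_6 | f i != g i]| == 1%N.

(* f and g are (k-1)-adjacent: they differ exactly in the face of index k
   (i.e. of actual rank k-1) *)
Definition adj_at (k : nat) (f g : {ffun 'I_6 -> T}) : bool :=
  (f != g) && [forall j : 'I_6, (j != k :> nat) ==> (f j == g j)].

Definition contains_common (f g x : {ffun 'I_6 -> T}) : bool :=
  [forall i : 'I_6, (f i == g i) ==> (x i == f i)].

Definition sfc_rel (f g : {ffun 'I_6 -> T}) : rel {ffun 'I_6 -> T} :=
  fun x y => [&& is_flag x, is_flag y, adjacent x y,
                 contains_common f g x & contains_common f g y].

Definition polytope4 : Prop :=
  [/\
      [/\ reflexive le, antisymmetric le & transitive le],
      (forall F, rk F <= 5)%N /\ (forall F G, ltf F G -> rk F < rk G)%N,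
      (exists2 Fmin, rk Fmin = 0%N & forall G, le Fmin G) /\
      (exists2 Fmax, rk Fmax = 5%N & forall G, le G Fmax),
      (* no gaps: every maximal chain meets every rank *)
      (forall F G, ltf F G -> (rk F).+1 < rk G ->
                   exists H, ltf F H && ltf H G)%N &
      (forall F G, le F G -> rk G = (rk F).+2 ->
                   #|[set H | ltf F H && ltf H G]| = 2%N) /\
      (forall f g, is_flag f -> is_flag g -> connect (sfc_rel f g) f g)].

Definition is_aut (s : {perm T}) : bool :=
  [forall x, forall y, le (s x) (s y) == le x y].

Definition flag_act (f : {ffun 'I_6 -> T}) (s : {perm T}) : {ffun 'I_6 -> T} :=
  [ffun i => s (f i)].

Definition same_orbit (f g : {ffun 'I_6 -> T}) : bool :=
  [exists s : {perm T}, is_aut s && (flag_act f s == g)].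

Definition chiral : Prop :=
  (forall f g, is_flag f -> is_flag g -> adjacent f g -> ~~ same_orbit f g) /\
  (forall f g h, is_flag f -> is_flag g -> is_flag h -> adjacent f g ->
      same_orbit f h || same_orbit g h).

(* number of (actual rank j-1)-faces of the rank-2 section G/F,
   F of actual rank j-2, G of actual rank j+1 *)
Definition sec_count (F G : T) : nat :=
  #|[set H | [&& ltf F H, ltf H G & rk H == (rk F).+1]]|.

(* equivelar of type {p,q,r}: every section G/F with F a (j-2)-face and
   G a (j+1)-face is a p_j-gon *)
Definition of_type (p q r : nat) : Prop :=
  forall F G, le F G ->
    [/\ rk F = 0%N -> rk G = 3%N -> sec_count F G = p,
        rk F = 1%N -> rk G = 4%N -> sec_count F G = q &
        rk F = 2%N -> rk G = 5%N -> sec_count F G = r].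

Definition num_flags : nat := #|[set f : {ffun 'I_6 -> T} | is_flag f]|.

Definition tight_of_type (p q r : nat) : Prop :=
  of_type p q r /\ num_flags = (2 * p * q * r)%N.

(* s is the standard generator sigma_i for base flag Phi (1 <= i <= 3):
   Phi s = Phi^{i,i-1}, i.e. (Phi^i)^{i-1} *)
Definition std_gen (Phi : {ffun 'I_6 -> T}) (i : nat) (s : {perm T}) : Prop :=
  is_aut s /\
  exists Psi, [&& is_flag Psi, adj_at i.+1 Phi Psi & adj_at i Psi (flag_act Phi s)].

End Polytope.

Definition zexpg (gT : finGroupType) (x : gT) (z : int) : gT :=
  match z with
  | Posz n => (x ^+ n)%g
  | Negz n => (x ^- n.+1)%g
  end.

(* Main.v *)
(** Write a, b, c for the standard generators, h = 2^(beta-2), z = b^h and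
    q = c^(e2 h), so z^2 = q^4 = 1 and 8 divides h.  Together with (bc)^2 = 1, the
    last two relations show that b centralizes c^8 and that conjugation by c^-1
    sends b^4 to b^-4 c^-8 q^2, while the first one shows that a centralizes b^4.
    The involution bc inverts a; conjugating by it, a centralizes c^8 q^2, which
    b centralizes too.  But ab inverts c, so (c^8 q^2)^2 = c^16 = 1, whereas c
    permutes transitively the 2^beta >= 32 faces of a rank-2 section. *)

Require Import Defs.
From HB Require Import structures.
From mathcomp Require Import all_boot all_order all_algebra all_fingroup.
From mathcomp Require Import cyclic zify.

(** * Flags, adjacency and the action of automorphisms *)

Section Flags.
Set Implicit Arguments.
Unset Strict Implicit.
Variables (T : finType) (le : rel T) (rk : T -> nat).
Implicit Types (f g : {ffun 'I_6 -> T}) (s w : {perm T}).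

(** Natural-number indices let the shifts [k.+1] and [i.-1] be plain arithmetic. Beyond 5, [inord]
    defaults to index 0, hence the bounds [k < 6] throughout. *)
Definition face f (k : nat) : T := f (inord k).

Lemma faceE f (i : 'I_6) : f i = face f i.
Proof. by rewrite /face inord_val. Qed.

Definition flag_of (u : nat -> T) : {ffun 'I_6 -> T} := [ffun i : 'I_6 => u i].

Lemma face_flag_of (u : nat -> T) k : k < 6 -> face (flag_of u) k = u k.
Proof. by move=> k6; rewrite /face ffunE inordK. Qed.

Lemma face_inj f g : (forall k, k < 6 -> face f k = face g k) -> f = g.
Proof. by move=> E; apply/ffunP => i; rewrite !faceE E. Qed.

Lemma face_act f s k : face (flag_act f s) k = s (face f k).
Proof. by rewrite /face ffunE. Qed.

Lemma adj_atP k f g :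
  reflect (f <> g /\ forall j, j < 6 -> j <> k -> face f j = face g j)
          (adj_at k f g).
Proof.
apply: (iffP andP) => -[/eqP nfg H]; split=> //.
  move=> j j6 jk; have /forallP/(_ (inord j)) := H.
  by rewrite inordK // => /implyP/(_ _)/eqP; apply; apply/eqP.
apply/forallP => i; apply/implyP => /eqP ik.
by rewrite !faceE H.
Qed.

Lemma adj_at_sym k f g : adj_at k f g -> adj_at k g f.
Proof.
move=> /adj_atP[n H]; apply/adj_atP; split; first by move/esym.
by move=> j j6 jk; rewrite H.
Qed.

Lemma adj_at_lt k f g : adj_at k f g -> k < 6.
Proof.
move=> /adj_atP[n H]; rewrite ltnNge; apply/negP => k6; apply: n.
by apply: face_inj => j j6; apply: H => // jk; lia.
Qed.

Lemma adj_at_neq k f g : adj_at k f g -> face f k <> face g k.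
Proof.
move=> /adj_atP[n H] E; apply: n; apply: face_inj => j j6.
by case: (j =P k) => [->//|/H->].
Qed.

Lemma adjacentP f g : reflect (exists k, adj_at k f g) (adjacent f g).
Proof.
apply: (iffP cards1P) => [[i Ei]|[k fg]].
  exists i; apply/adj_atP; split=> [fg|j j6 ji].
    by have := set11 i; rewrite -Ei inE fg eqxx.
  have : inord j \notin [set i].
    by rewrite inE -val_eqE /= inordK //; apply/eqP.
  by rewrite -Ei inE negbK => /eqP.
have k6 := adj_at_lt fg; exists (inord k); apply/setP => j.
rewrite !inE -val_eqE /= inordK //.
case: (val j =P k) => [/= jk|/= jk].
  by rewrite !faceE jk; apply/eqP/adj_at_neq.
by move/adj_atP: fg => [_ H]; rewrite !faceE H ?eqxx.
Qed.

Lemma flag_act1 f : flag_act f 1%g = f.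
Proof. by apply/ffunP => i; rewrite ffunE perm1. Qed.

Lemma flag_actM f s w : flag_act (flag_act f s) w = flag_act f (s * w)%g.
Proof. by apply/ffunP => i; rewrite !ffunE permM. Qed.

Lemma adj_at_act k f g s :
  adj_at k f g -> adj_at k (flag_act f s) (flag_act g s).
Proof.
move=> /adj_atP[n H]; apply/adj_atP; split.
  move=> E; apply: n; have := congr1 (fun x => flag_act x s^-1%g) E.
  by rewrite /= !flag_actM mulgV !flag_act1.
by move=> j j6 jk; rewrite !face_act H.
Qed.

Lemma is_autP s : reflect (forall x y, le (s x) (s y) = le x y) (is_aut le s).
Proof.
by apply: (iffP forallP) => H x; [move=> y; have /forallP/(_ y)/eqP := H x
  | apply/forallP => y; rewrite H].
Qed.

Lemma is_aut1 : is_aut le 1.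
Proof. by apply/is_autP => x y; rewrite !perm1. Qed.

Lemma is_autM s w : is_aut le s -> is_aut le w -> is_aut le (s * w).
Proof. by move=> /is_autP hs /is_autP hw; apply/is_autP => x y; rewrite !permM hw hs. Qed.

Lemma is_autV s : is_aut le s -> is_aut le s^-1.
Proof. by move=> /is_autP hs; apply/is_autP => x y; rewrite -hs !permKV. Qed.

Lemma is_aut_cycle s w : is_aut le s -> w \in <[s]>%g -> is_aut le w.
Proof.
move=> hs /cycleP[n ->]; elim: n => [|n IH]; first by rewrite expg0 is_aut1.
by rewrite expgS is_autM.
Qed.

(** * Consequences of the polytope axioms *)

Hypothesis P : polytope4 le rk.

Let lexx : reflexive le. Proof. by case: P => [[]]. Qed.
Let le_tr : transitive le. Proof. by case: P => [[]]. Qed.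
Let rk_le5 F : rk F <= 5. Proof. by case: P => _ [H _] _ _ _. Qed.
Let rk_lt F G : ltf le F G -> rk F < rk G.
Proof. by case: P => _ [_ H] _ _ _; apply: H. Qed.
Let no_gap F G : ltf le F G -> (rk F).+1 < rk G ->
  exists H, ltf le F H && ltf le H G.
Proof. by case: P => _ _ _ H _; apply: H. Qed.
Let diamond F G : le F G -> rk G = (rk F).+2 ->
  #|[set H | ltf le F H && ltf le H G]| = 2.
Proof. by case: P => _ _ _ _ [H _]; apply: H. Qed.
Let connected f g : is_flag le rk f -> is_flag le rk g ->
  connect (sfc_rel le rk f g) f g.
Proof. by case: P => _ _ _ _ [_ H]; apply: H. Qed.

Lemma ltf_le_rk x y : le x y -> rk x < rk y -> ltf le x y.
Proof. by move=> lxy rxy; rewrite /ltf lxy andbT; apply: contraTneq rxy => ->; rewrite ltnn. Qed.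

Lemma ltfW x y : ltf le x y -> le x y.
Proof. by case/andP. Qed.

Lemma ltf_trans x y z : ltf le x y -> ltf le y z -> ltf le x z.
Proof.
move=> xy yz; apply: ltf_le_rk; first exact: le_tr (ltfW xy) (ltfW yz).
exact: ltn_trans (rk_lt xy) (rk_lt yz).
Qed.

Lemma rk0_eq x y : rk x = 0 -> rk y = 0 -> x = y.
Proof.
case: P => _ _ [[m m0 mle] _] _ _.
suff E z : rk z = 0 -> z = m by move=> /E-> /E->.
move=> z0; apply/eqP/negPn/negP => zm.
have : rk m < rk z by apply: rk_lt; rewrite /ltf mle eq_sym zm.
by rewrite m0 z0.
Qed.

Lemma rk5_eq x y : rk x = 5 -> rk y = 5 -> x = y.
Proof.
case: P => _ _ [_ [m m0 mle]] _ _.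
suff E z : rk z = 5 -> z = m by move=> /E-> /E->.
move=> z0; apply/eqP/negPn/negP => zm.
have : rk z < rk m by apply: rk_lt; rewrite /ltf mle zm.
by rewrite m0 z0.
Qed.

(** Among the faces strictly below [x], take one of maximal rank: if it were not of rank [n], the
    absence of gaps would give a face between it and [x]. *)
Lemma face_below x n : rk x = n.+1 -> exists2 y, ltf le y x & rk y = n.
Proof.
move=> rx; case: P => _ _ [[m m0 mle] _] _ _.
have mx : ltf le m x by apply: ltf_le_rk; rewrite ?mle // m0 rx.
case: (@arg_maxnP _ m (fun y => ltf le y x) rk mx) => y yx ymax.
exists y => //; apply/eqP; have := rk_lt yx; rewrite rx ltnS leq_eqVlt.
case/orP=> // yn; have [|z /andP[yz zx]] := no_gap yx; first by rewrite rx; lia.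
by have := ymax _ zx; have := rk_lt yz; lia.
Qed.

Lemma face_above x n : n < 5 -> rk x = n -> exists2 y, ltf le x y & rk y = n.+1.
Proof.
move=> n5 rx; case: P => _ _ [_ [m m0 mle]] _ _.
have mx : ltf le x m by apply: ltf_le_rk; rewrite ?mle // m0 rx.
case: (@arg_minnP _ m (fun y => ltf le x y) rk mx) => y yx ymin.
exists y => //; apply/eqP; have := rk_lt yx; rewrite rx leq_eqVlt eq_sym.
case/orP=> // yn; have [|z /andP[yz zx]] := no_gap yx; first by rewrite rx; lia.
by have := ymin _ yz; have := rk_lt zx; lia.
Qed.

(** Automorphisms are only assumed to preserve the order. Induction through a face one rank below
    shows that no rank decreases; applying this to the inverse gives equality. *)
Lemma rk_aut s x : is_aut le s -> rk (s x) = rk x.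
Proof.
suff H w y : is_aut le w -> rk y <= rk (w y).
  move=> hs; apply/eqP; rewrite eqn_leq H // andbT.
  by have := H _ (s x) (is_autV hs); rewrite permK.
move=> /is_autP hw; move En: (rk y) => n; elim: n y En => // n IH y ry.
have [z zy rz] := face_below ry.
have wzy : ltf le (w z) (w y).
  by move: zy; rewrite /ltf hw (inj_eq perm_inj).
exact: leq_ltn_trans (IH _ rz) (rk_lt wzy).
Qed.

Lemma is_flagP f :
  reflect ((forall k, k < 6 -> rk (face f k) = k) /\
           (forall k, k < 5 -> le (face f k) (face f k.+1)))
          (is_flag le rk f).
Proof.
apply: (iffP andP) => -[R L].
  split=> k k6; first by have /forallP/(_ (inord k))/eqP := R; rewrite inordK.
  have /forallP/(_ (inord k))/forallP/(_ (inord k.+1)) := L.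
  by rewrite !inordK ?leqnSn //; lia.
split; first by apply/forallP => i; rewrite faceE R.
apply/forallP => i; apply/forallP => j; apply/implyP; rewrite !faceE.
have := ltn_ord j; move: (val i) (val j) => /= {}i {}j.
elim: j => [|j IH] j6; first by rewrite leqn0 => /eqP->.
rewrite leq_eqVlt => /predU1P[->//|ij].
by apply: le_tr (L _ _) => //; apply: IH; lia.
Qed.

Lemma flag_rk f k : is_flag le rk f -> k < 6 -> rk (face f k) = k.
Proof. by move=> /is_flagP[R _]; apply: R. Qed.

Lemma flag_le f k : is_flag le rk f -> k < 5 -> le (face f k) (face f k.+1).
Proof. by move=> /is_flagP[_ L]; apply: L. Qed.

Lemma flag_lt f k : is_flag le rk f -> k < 5 -> ltf le (face f k) (face f k.+1).
Proof.
by move=> hf k5; rewrite ltf_le_rk ?flag_le ?flag_rk //; lia.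
Qed.

Lemma flag_act_flag f s : is_aut le s -> is_flag le rk f -> is_flag le rk (flag_act f s).
Proof.
move=> hs hf; apply/is_flagP; split=> k k6; first by rewrite face_act rk_aut ?flag_rk.
by rewrite !face_act (is_autP _ hs) flag_le.
Qed.

(** At index 0 or 5 there is no adjacent flag, the least and greatest faces being unique. Elsewhere
    the faces of [f], [g], [g'] at [k] all lie between the same two neighbours, and the diamond
    condition leaves room for two only. *)
Lemma adj_at_unique k f g g' :
  is_flag le rk f -> is_flag le rk g -> is_flag le rk g' ->
  adj_at k f g -> adj_at k f g' -> g = g'.
Proof.
move=> hf hg hg' fg fg'; have k6 := adj_at_lt fg.
have nfg := adj_at_neq fg; have nfg' := adj_at_neq fg'.
case: k => [|k] in k6 fg fg' nfg nfg' *.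
  by case: nfg; apply: rk0_eq; rewrite flag_rk.
case: (ltnP k.+1 5) => k5; last first.
  have k4 : k.+1 = 5 by lia.
  by case: nfg; apply: rk5_eq; rewrite flag_rk.
move/adj_atP: (fg) => [_ E]; move/adj_atP: (fg') => [_ E'].
apply: face_inj => j j6; case: (j =P k.+1) => [->{j j6}|jk]; last by rewrite -E ?E'.
have lt2 x : is_flag le rk x -> face f k = face x k ->
    face f k.+2 = face x k.+2 ->
    ltf le (face f k) (face x k.+1) && ltf le (face x k.+1) (face f k.+2).
  by move=> hx -> ->; rewrite !flag_lt //; lia.
have := @diamond (face f k) (face f k.+2).
rewrite !flag_rk; try lia.
move=> /(_ (ltfW (ltf_trans (flag_lt hf _) (flag_lt hf _))) erefl).
move=> /(_ (ltnW k5) k5).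
set A := [set _ | _] => cA; apply/eqP/negPn/negP => ngg'.
have : [set face f k.+1; face g k.+1; face g' k.+1] \subset A.
  by apply/subsetP => x; rewrite !inE => /orP[/orP[]|] /eqP->;
     apply: lt2 => //; (apply: E || apply: E'); lia.
move/subset_leq_card; rewrite cA setUC cardsU1 cards2 !inE.
rewrite ![face g' _ == _]eq_sym (negbTE ngg').
by move/eqP/negbTE: nfg => ->; move/eqP/negbTE: nfg' => ->.
Qed.

(** Strong flag-connectedness as an induction principle: the step only has to treat adjacent flags
    that both contain the common faces of [f] and [g]. *)
Lemma flag_ind_connect (X : {ffun 'I_6 -> T} -> Prop) f g :
  is_flag le rk f -> is_flag le rk g -> X f ->
  (forall x y, sfc_rel le rk f g x y -> X x -> X y) -> X g.
Proof.
move=> hf hg Xf step; have /connectP[p hp ->] := connected hf hg.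
suff: forall x, X x -> path (sfc_rel le rk f g) x p -> X (last x p) by apply.
elim: p {hp} => //= y p IH x Xx /andP[xy yp].
exact: IH (step _ _ xy Xx) yp.
Qed.

(** A chain is built one rank at a time down to rank 0 and up to rank 5, and the two are glued at
    [x]. *)
Lemma face_in_flag x : exists2 f, is_flag le rk f & face f (rk x) = x.
Proof.
have down n y : rk y = n -> exists u : nat -> T,
    [/\ u n = y, forall k, k <= n -> rk (u k) = k &
        forall k, k < n -> le (u k) (u k.+1)].
  elim: n y => [|n IH] y ry.
    by exists (fun=> y); split=> // k; rewrite leqn0 => /eqP->.
  have [z zy /IH[u [un ur ul]]] := face_below ry.
  exists (fun k => if k <= n then u k else y); split=> [|k kn|k kn].
  - by rewrite ltnn.
  - case: ifP => [/ur//|/negbT]; rewrite -ltnNge => nk.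
    by rewrite ry; lia.
  - have -> : k <= n by lia.
    case: ifP => [/ul//|/negbT]; rewrite -ltnNge => nk.
    have -> : k = n by lia.
    by rewrite un ltfW.
have up m : forall n y, n + m = 5 -> rk y = n -> exists u : nat -> T,
    [/\ u n = y, forall k, n <= k < 6 -> rk (u k) = k &
        forall k, n <= k < 5 -> le (u k) (u k.+1)].
  elim: m => [|m IH] n y nm ry.
    by exists (fun=> y); split=> // k; lia.
  have [|z zy /IH[|u [un ur ul]]] := face_above _ ry; first lia.
    by lia.
  exists (fun k => if n < k then u k else y); split=> [|k kn|k kn].
  - by rewrite ltnn.
  - case: ifP => [nk|/negbT]; first by apply: ur; lia.
    by rewrite -leqNgt => nk; rewrite ry; lia.
  - have -> : n < k.+1 by lia.
    case: ifP => [nk|/negbT]; first by apply: ul; lia.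
    rewrite -leqNgt => nk; have -> : k = n by lia.
    by rewrite un ltfW.
have x5 := rk_le5 x; have [d [dn dr dl]] := down _ x erefl.
have [|u [un ur ul]] := up (5 - rk x) (rk x) x _ erefl; first lia.
exists (flag_of (fun k => if k <= rk x then d k else u k)); last first.
  by rewrite face_flag_of ?leqnn.
apply/is_flagP; split=> k k6; rewrite !face_flag_of; try lia.
  by case: ifP => [/dr//|/negbT]; rewrite -ltnNge => nk; apply: ur; lia.
case: ifP => [kx|/negbT]; last first.
  by rewrite -ltnNge => nk; rewrite ifF; [apply: ul|]; lia.
case: ifP => [/dl//|/negbT]; rewrite -ltnNge => nk.
have -> : k = rk x by lia.
by rewrite dn -[X in le X _]un; apply: ul; lia.
Qed.

(** By uniqueness of adjacent flags, being fixed passes from a flag to its neighbours, hence to all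
    flags, and every face lies in some flag. *)
Lemma aut_fix_flag f s : is_aut le s -> is_flag le rk f -> flag_act f s = f -> s = 1%g.
Proof.
move=> hs hf fs.
have fixall g : is_flag le rk g -> flag_act g s = g.
  move=> hg; apply: (@flag_ind_connect (fun g => flag_act g s = g) _ _ hf hg fs) => x y.
  move=> /and5P[hx hy /adjacentP[k xy] _ _] sx.
  apply: (adj_at_unique hx _ hy _ xy); first exact: flag_act_flag.
  by rewrite -[X in adj_at _ X _]sx; apply: adj_at_act.
apply/permP => x; rewrite perm1; have [g hg gx] := face_in_flag x.
by rewrite -[in RHS]gx -(fixall _ hg) face_act gx.
Qed.

(** * Rotations relative to the base flag, and their products *)

Variables (Phi : {ffun 'I_6 -> T}) (flagPhi : is_flag le rk Phi).

(* [std_gen le rk Phi i] is convertible to [rot_at i.+1 i]. *)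
Definition rot_at k l w : Prop :=
  is_aut le w /\
  exists Psi, [&& is_flag le rk Psi, adj_at k Phi Psi & adj_at l Psi (flag_act Phi w)].

(** The two changes at [l] cancel: [Psi] is the base flag changed at [l], so [Psi w] and [Psi'] are
    both adjacent to [Phi w] at [l] and therefore coincide. *)
Lemma rot_at_mul k l m s w :
  rot_at l m s -> rot_at k l w -> rot_at k m (s * w).
Proof.
move=> [hs [Psi /and3P[hPsi PPsi Psis]]] [hw [Psi' /and3P[hPsi' PPsi' Psiw]]].
split; first exact: is_autM.
exists Psi'; rewrite hPsi' PPsi' -flag_actM.
suff -> : Psi' = flag_act Psi w by apply: adj_at_act.
apply: (@adj_at_unique l (flag_act Phi w)) => //; try exact: flag_act_flag.
  exact: adj_at_sym.
exact: adj_at_act.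
Qed.

(* Nonconsecutive flag changes commute. *)
Lemma rot_at_sq k l w : l.+1 < k -> rot_at k l w -> (w ^+ 2 = 1)%g.
Proof.
move=> lk [hw [Psi /and3P[hPsi PPsi Psiw]]].
have k6 := adj_at_lt PPsi.
have hPw := flag_act_flag hw flagPhi.
(* [Th] is the base flag changed at [l] alone. It is a flag because [k] and [l] are not consecutive,
   so each incidence already occurs in [Phi] or in [Phi w]. *)
pose Th := flag_of (fun j => if j == l then face (flag_act Phi w) j else face Phi j).
have PE j : j < 6 -> j <> k -> j <> l -> face (flag_act Phi w) j = face Phi j.
  move=> j6 jk jl; move/adj_atP: PPsi => [_ ->] //.
  by move/adj_atP: Psiw => [_ ->].
have hTh : is_flag le rk Th.
  apply/is_flagP; split=> j j6; rewrite !face_flag_of; try lia.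
    by case: ifP => _; rewrite flag_rk.
  case: eqP => [jl|jl]; case: eqP => [jl'|jl']; try lia.
  - by rewrite -PE; [apply: flag_le | lia ..].
  - by rewrite -PE; [apply: flag_le | lia ..].
  - exact: flag_le.
have lkN : l <> k by lia.
have l6 := adj_at_lt Psiw.
have PwPsi : face Psi l = face Phi l.
  by move/adj_atP: PPsi => [_ ->].
have PTh : adj_at l Phi Th.
  apply/adj_atP; split=> [E|j j6 jl]; last first.
    by rewrite face_flag_of //; case: eqP.
  have := adj_at_neq Psiw; rewrite PwPsi E face_flag_of // eqxx; apply.
  by rewrite -E.
have PwTh : adj_at k (flag_act Phi w) Th.
  apply/adj_atP; split=> [E|j j6 jk]; last first.
    by rewrite face_flag_of //; case: eqP => // jl; rewrite PE.
  have := adj_at_neq PPsi; apply.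
  have -> : face Psi k = face (flag_act Phi w) k.
    by move/adj_atP: Psiw => [_ -> //]; apply: nesym.
  by rewrite E face_flag_of //; case: eqP => // kl; case: lkN.
(* Both are adjacent to [Phi w] at [k]. Then [Phi w w] and [Phi] are both adjacent to [Th] at [l],
   so they are equal. *)
have PsiTh : flag_act Psi w = Th.
  by apply: (adj_at_unique hPw _ hTh (adj_at_act _ PPsi) PwTh); apply: flag_act_flag.
apply: (aut_fix_flag _ flagPhi); first by rewrite expgS expg1; apply: is_autM.
rewrite expgS expg1 -flag_actM.
apply: (@adj_at_unique l Th) => //.
- by apply: flag_act_flag.
- by rewrite -PsiTh; apply: adj_at_act.
- exact: adj_at_sym.
Qed.

(** * The action of one generator on its rank-2 section *)

Section Rotation.
Variables (i : nat) (s : {perm T}).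
Hypotheses (i_gt0 : 0 < i) (i_lt4 : i < 4) (rot : rot_at i.+1 i s).

(** Walking from [Phi] to [g] inside the section meets only flags [Phi w] and [Psi w] with [w] a
    power of [s]: a change at [i.+1] swaps [Phi w] and [Psi w], a change at [i] swaps [Psi w] and
    [Phi (s w)]. *)
Lemma rot_section_flag g :
  is_flag le rk g ->
  (forall j, j < 6 -> j <> i -> j <> i.+1 -> face g j = face Phi j) ->
  exists2 w, w \in <[s]>%g & face g i = w (face Phi i).
Proof.
move=> hg gE; have [hs [Psi /and3P[hPsi PPsi Psis]]] := rot.
have awf w x : w \in <[s]>%g -> is_flag le rk x -> is_flag le rk (flag_act x w).
  by move=> /(is_aut_cycle hs) hw; apply: flag_act_flag.
suff [w ws gw] : exists2 w, w \in <[s]>%g & g = flag_act Phi w \/ g = flag_act Psi w.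
  exists w => //; case: gw => ->; rewrite face_act //.
  by move/adj_atP: PPsi => [_ ->] //; lia.
pose X g := exists2 w, w \in <[s]>%g & g = flag_act Phi w \/ g = flag_act Psi w.
apply: (@flag_ind_connect X _ _ flagPhi hg).
  by exists 1%g; rewrite ?group1 // flag_act1; left.
move=> x y /and5P[hx hy /adjacentP[k xy] cx cy] [w ws xw].
have common z j : contains_common Phi g z -> j < 6 -> j <> i -> j <> i.+1 ->
    face z j = face Phi j.
  move=> /forallP/(_ (inord j)) /implyP cz j6 ji ji1; apply/eqP/cz.
  by apply/eqP; rewrite [RHS]gE.
have k6 := adj_at_lt xy.
have ss := cycle_id s.
have := adj_at_neq xy; case: (k =P i.+1) => [ki _|ki1].
  exists w => //; rewrite ki in xy; case: xw => xw; [right|left].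
    apply: (adj_at_unique hx hy _ xy); first exact: awf.
    by rewrite xw; apply: adj_at_act.
  apply: (adj_at_unique hx hy _ xy); first exact: awf.
  by rewrite xw; apply: adj_at_act; apply: adj_at_sym.
(* A change at any other index is impossible, since both flags keep the face shared by [Phi] and [g]
   there. *)
case: (k =P i) => [ki _|ki]; last by case; rewrite !common.
rewrite ki in xy; case: xw => xw.
  have s'w : (s^-1 * w)%g \in <[s]>%g by rewrite groupM ?groupV.
  exists (s^-1 * w)%g => //; right.
  apply: (adj_at_unique hx hy _ xy); first exact: awf.
  rewrite xw; have -> : flag_act Phi w = flag_act (flag_act Phi s) (s^-1 * w)%g.
    by rewrite flag_actM mulKVg.
  by apply: adj_at_act; apply: adj_at_sym.
have sw : (s * w)%g \in <[s]>%g by rewrite groupM.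
exists (s * w)%g => //; left.
apply: (adj_at_unique hx hy _ xy); first exact: awf.
by rewrite xw -flag_actM; apply: adj_at_act.
Qed.

Lemma rot_fix j w : w \in <[s]>%g -> j < 6 -> j <> i -> j <> i.+1 ->
  w (face Phi j) = face Phi j.
Proof.
move=> /cycleP[n ->] j6 ji ji1; have [hs [Psi /and3P[hPsi PPsi Psis]]] := rot.
have sj : s (face Phi j) = face Phi j.
  rewrite -face_act; move/adj_atP: PPsi => [_ ->] //.
  by move/adj_atP: Psis => [_ ->].
by elim: n => [|n IH]; rewrite ?perm1 // expgS permM sj.
Qed.

(** A face of the section extends, together with a face above it, to a flag agreeing with [Phi]
    outside [i] and [i.+1], so a power of [s] reaches it. Conversely, powers of [s] fix both ends of
    the section. *)
Lemma section_porbit :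
  sec_count le rk (face Phi i.-1) (face Phi i.+2) = #|porbit s (face Phi i)|.
Proof.
apply: eq_card => H; rewrite inE; have [hs _] := rot.
have rF : rk (face Phi i.-1) = i.-1 by rewrite flag_rk //; lia.
have ei : i.-1.+1 = i by lia.
rewrite rF ei; apply/idP/porbitP => [/and3P[FH HG /eqP rH]|[n ->]].
  have [|K /andP[HK KG]] := no_gap HG; first by rewrite rH flag_rk //; lia.
  have rK : rk K = i.+1.
    have := rk_lt HK; have := rk_lt KG; rewrite rH flag_rk //; lia.
  pose g := flag_of (fun j => if j == i then H else
                              if j == i.+1 then K else face Phi j).
  have hg : is_flag le rk g.
    apply/is_flagP; split=> j j6; rewrite !face_flag_of; try lia.
      by case: eqP => [->//|_]; case: eqP => [->//|_]; apply: flag_rk.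
    case: (j =P i) => [->|ji].
      by rewrite eqxx ifN_eqC ?ltfW //; lia.
    case: (j =P i.+1) => [->|ji1].
      by rewrite !ifN ?ltfW //; lia.
    case: eqP => [ji2|ji2].
      have -> : j = i.-1 by lia.
      exact: ltfW.
    by rewrite ifN ?flag_le //; lia.
  have [|w /cycleP[n ->]] := rot_section_flag hg.
    by move=> j j6 ji ji1; rewrite face_flag_of //; do 2 case: eqP => //.
  by rewrite face_flag_of ?eqxx; [exists n | lia].
have ws : (s ^+ n)%g \in <[s]>%g by apply: mem_cycle.
have hw := is_aut_cycle hs ws.
rewrite rk_aut // flag_rk // ?eqxx ?andbT; last lia.
rewrite -(@rot_fix i.-1 _ ws); try lia.
rewrite -(@rot_fix i.+2 _ ws); try lia.
have act_lt x y : ltf le x y -> ltf le ((s ^+ n)%g x) ((s ^+ n)%g y).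
  by rewrite /ltf (is_autP _ hw) (inj_eq perm_inj).
apply/andP; split; apply: act_lt; last first.
  by apply: (@ltf_trans _ (face Phi i.+1)); apply: flag_lt; lia.
by rewrite -{2}ei; apply: flag_lt; lia.
Qed.

Lemma section_le_order :
  sec_count le rk (face Phi i.-1) (face Phi i.+2) <= #[s]%g.
Proof.
by rewrite section_porbit porbit.unlock; apply: leq_imset_card.
Qed.

(* The power fixes every face of [Phi] except possibly the one of index [i.+1];
   chirality forbids moving [Phi] to an adjacent flag. *)
Lemma rot_order : chiral le rk ->
  (s ^+ sec_count le rk (face Phi i.-1) (face Phi i.+2) = 1)%g.
Proof.
move=> [chi _]; rewrite section_porbit.
set n := #|_|; have [hs _] := rot.
have ws : (s ^+ n)%g \in <[s]>%g by apply: mem_cycle.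
have hw := is_aut_cycle hs ws.
apply: (aut_fix_flag hw flagPhi).
apply/eqP/negPn/negP => nE.
have hw' := flag_act_flag hw flagPhi.
have : adjacent Phi (flag_act Phi (s ^+ n)%g).
  apply/adjacentP; exists i.+1; apply/adj_atP; split.
    by move=> E; rewrite -E eqxx in nE.
  move=> j j6 ji1; rewrite face_act; case: (j =P i) => [->|ji].
    by rewrite permX iter_porbit.
  by rewrite rot_fix.
move/(chi _ _ flagPhi hw')/negP; apply.
by apply/existsP; exists (s ^+ n)%g; rewrite hw eqxx.
Qed.

End Rotation.
End Flags.

(** * The group relations force [c ^+ 16 = 1] *)

Section Collapse.
Set Implicit Arguments.
Unset Strict Implicit.
Local Open Scope group_scope.
(** Here [8 * m] is the exponent h, and [y] stands for z^e1, whose sign is immaterial because z is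
    its own inverse. *)
Variables (gT : finGroupType) (a b c y z q : gT) (m : nat).
Hypotheses (ab2 : (a * b) ^+ 2 = 1) (bc2 : (b * c) ^+ 2 = 1)
  (abc2 : (a * b * c) ^+ 2 = 1).
Hypotheses (zE : z = b ^+ (8 * m)) (z2 : z ^+ 2 = 1) (y1z : y = 1 \/ y = z).
Hypotheses (qE : q = c ^+ (8 * m) \/ q = c ^- (8 * m)) (q4 : q ^+ 4 = 1).
Hypotheses (Rab : b * a^-1 = a * (b ^+ 3 * y))
  (Rbc : c^-1 * b = b^-1 * z * (c ^- 3 * q))
  (Rcb : c * b^-1 = b * z * (c ^+ 3 * q)).

Let qc : commute q c.
Proof.
by case: qE => ->; apply: commute_sym; [|apply: commuteV]; apply: commuteX.
Qed.
Let zb : commute z b.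
Proof. by rewrite zE; apply: commute_sym; apply: commuteX. Qed.
Let zV : z^-1 = z.
Proof. by apply: (mulgI z); rewrite mulgV -z2 expgS expg1. Qed.
Let qVV : q ^- 2 = q ^+ 2.
Proof. by apply: (mulgI (q ^+ 2)); rewrite mulgV -expgD q4. Qed.

Let cbc : c * b * c = b^-1.
Proof. by apply: (mulgI b); rewrite mulgV -bc2 expgS expg1 !mulgA. Qed.

(** Multiplied by [c] on the right, the left side becomes [c * (c * b * c)], which is [c * b^-1]:
    this is the relation [Rcb] with one [c] cancelled. *)
Let c2_b : c ^+ 2 * b = b * z * (c ^+ 2 * q).
Proof.
apply: (mulIg c); transitivity (c * b^-1).
  by rewrite -cbc expgS expg1 !mulgA.
by rewrite Rcb -!mulgA qc.
Qed.

Let qcV : q * c^-1 = c^-1 * q.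
Proof. exact: commuteV. Qed.

Let c2V_bV : c ^- 2 * b^-1 = b^-1 * z * (c ^- 2 * q).
Proof.
apply: (mulIg c^-1); transitivity (c^-1 * b).
  by rewrite -cbc [c ^+ 2]expgS expg1 invMg -!mulgA mulgV mulg1 mulKg.
by rewrite Rbc [c ^+ 3]expgS invMg -!mulgA qcV.
Qed.

(** Inverting [c2V_bV] gives a second expression for [b * z], to be compared with the one in
    [c2_b]. *)
Let bz_c2 : b * z = q * (c ^- 2 * (b * c ^+ 2)).
Proof.
have qVc2 : q^-1 * (c * c) = c * c * q^-1.
  apply: commute_sym; apply: commuteV; apply: commute_sym.
  exact: (commuteM qc qc).
have := congr1 invg c2V_bV; rewrite !invMg !invgK zV zb => ->.
by rewrite qVc2 -!mulgA !mulKg mulKVg.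
Qed.

(** Eliminating [b * z] between [c2_b] and [bz_c2] gives [c ^+ 4 * b = q * b * c ^+ 4 * q]. *)
Let c4_b : (c ^+ 4 * q^-1) ^ b = c ^+ 4 * q.
Proof.
suff H d : commute q d -> d * b = b * z * (d * q) ->
    b * z = q * (d^-1 * (b * d)) -> (d * d * q^-1) ^ b = d * d * q.
  rewrite (_ : c ^+ 4 = c ^+ 2 * c ^+ 2); last by rewrite -expgD.
  by apply: H => //; apply: commuteX.
move=> qd H1 H2; apply: (mulgI b); rewrite -conjgC; apply: (mulgI q).
rewrite !mulgA qd -[d * q * d]mulgA qd mulgA mulgK -[d * d * b]mulgA H1 H2.
by rewrite !mulgA -qd mulgK.
Qed.

Let q2E : q ^+ 2 = c ^+ (16 * m).
Proof.
have c4 : c ^+ (16 * m) = (c ^+ (8 * m)) ^+ 2 by rewrite -expgM; congr (_ ^+ _); lia.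
by case: qE => qe; rewrite c4 -?qe // -qVV qe expgVn invgK.
Qed.

(** [q ^+ 2] is the power [4 * m] of [c ^+ 4], and raising [c4_b] to that power kills the factors
    [q]. *)
Let q2_b : commute (q ^+ 2) b.
Proof.
have qm : q ^+ (4 * m) = 1 by rewrite expgM q4 expg1n.
rewrite q2E (_ : 16 * m = 4 * (4 * m))%N; last lia.
rewrite expgM /commute conjgC; congr (_ * _).
have : commute (c ^+ 4) q by apply: commute_sym; apply: commuteX.
move: c4_b; move: (c ^+ 4) => e eb eq.
have := congr1 (fun x => x ^+ (4 * m)) eb; rewrite /= -conjXg !expgMn //.
  by rewrite expgVn qm invg1 !mulg1.
exact: commuteV.
Qed.

(** The square of [c4_b], since [q ^- 2 = q ^+ 2]. *)
Let g_b : commute (c ^+ 8 * q ^+ 2) b.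
Proof.
rewrite /commute conjgC; congr (_ * _).
have : commute (c ^+ 4) q by apply: commute_sym; apply: commuteX.
rewrite (_ : 8 = 4 * 2)%N // expgM; move: c4_b; move: (c ^+ 4) => e eb eq.
have := congr1 (fun x => x ^+ 2) eb; rewrite /= -conjXg !expgMn //.
  by rewrite expgVn qVV.
exact: commuteV.
Qed.

Let c8_b : commute b (c ^+ 8).
Proof.
have -> : c ^+ 8 = (c ^+ 8 * q ^+ 2) * q ^- 2 by rewrite mulgK.
apply: commuteM; first exact: commute_sym.
by apply: commuteV; apply: commute_sym.
Qed.

(** The divisibility of h by 8 enters here: [q] is a power of [c ^+ 8]. *)
Let q_b : commute b q.
Proof. by case: qE => ->; rewrite expgM; do ?apply: commuteV; apply: commuteX. Qed.

(** Each conjugation by [b] multiplies [c ^+ 2] by [z] and [q], which [b] centralizes; after two of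
    them the factors [z] cancel. *)
Let c2_conj_b2 : (c ^+ 2) ^ (b ^+ 2) = c ^+ 2 * q ^+ 2.
Proof.
have E : (c ^+ 2) ^ b = z * (c ^+ 2 * q).
  by apply: (mulgI b); rewrite -conjgC c2_b -[b * z * _]mulgA.
have zJ : z ^ b = z by rewrite conjgE zb mulKg.
have qJ : q ^ b = q by rewrite conjgE -q_b mulKg.
move: E; move: (c ^+ 2) => d E.
by rewrite [b ^+ 2]expgS expg1 conjgM E !conjMg E zJ qJ !mulgA -[z * z]/(z ^+ 2) z2 mul1g.
Qed.

Let q2J : (q ^+ 2) ^ (b ^+ 2) = q ^+ 2.
Proof.
have h : commute (q ^+ 2) (b ^+ 2) by apply: commuteX.
by rewrite conjgE h mulKg.
Qed.

(** Conjugation by [b ^+ 4] multiplies [c ^+ 2] by [q ^+ 4 = 1], and [z] is a power of [b ^+ 4]. *)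
Let z_c2 : commute z (c ^+ 2).
Proof.
have h : commute (c ^+ 2) (b ^+ 4).
  rewrite /commute conjgC; congr (_ * _).
  rewrite (_ : b ^+ 4 = b ^+ 2 * b ^+ 2); last by rewrite -expgD.
  by rewrite conjgM c2_conj_b2 conjMg q2J c2_conj_b2 -mulgA -expgD q4 mulg1.
apply: commute_sym; rewrite zE (_ : 8 * m = 4 * (2 * m))%N; last lia.
by rewrite expgM; apply: commuteX.
Qed.

Let b2_c4 : commute (b ^+ 2) (c ^+ 4).
Proof.
apply: commute_sym; rewrite /commute conjgC; congr (_ * _).
rewrite (_ : 4 = 2 * 2)%N // expgM conjXg c2_conj_b2 expgMn.
  by rewrite -[q ^+ 2 ^+ 2]expgM q4 mulg1.
by apply: commuteX; apply: commute_sym; apply: commuteX.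
Qed.

(** From [c * b * c = b^-1], the conjugate of [b] is [b^-1 * c ^- 2]. It is squared twice: first by
    [c2V_bV], then with all factors commuting and [z ^+ 2 = 1]. *)
Let b4_conj_c : (b ^+ 4) ^ c^-1 = b ^- 4 * (c ^- 8 * q ^+ 2).
Proof.
have qcn n : commute q (c ^- n) by apply: commuteV; apply: commuteX.
have b1 : b ^ c^-1 = b^-1 * c ^- 2.
  by rewrite -cbc [c ^+ 2]expgS expg1 invMg conjgE invgK -!mulgA mulKVg.
have b2 : (b ^+ 2) ^ c^-1 = (b ^- 2 * z) * (c ^- 4 * q).
  rewrite conjXg b1 [X in X = _]expgS expg1.
  transitivity (b^-1 * (c ^- 2 * b^-1) * c ^- 2); first by rewrite !mulgA.
  rewrite c2V_bV.
  have -> : b ^- 2 = b^-1 * b^-1 by rewrite expgS expg1 invMg.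
  have -> : c ^- 4 = c ^- 2 * c ^- 2 by rewrite -invMg -expgD.
  by move: (c ^- 2) (qcn 2) => d qd; rewrite -!mulgA qd.
have zb2 : commute (b ^- 2) z.
  by apply: commute_sym; apply: commuteV; apply: commuteX.
have zc4 : commute z (c ^+ 4).
  by rewrite (_ : 4 = 2 * 2)%N // expgM; apply: commuteX.
have comm : commute (b ^- 2 * z) (c ^- 4 * q).
  apply: commuteM.
    apply: commuteV; apply: commute_sym; apply: commuteM; last exact: commute_sym.
    by apply: commuteV; apply: commute_sym.
  apply: commute_sym; apply: commuteM.
    by apply: commuteV; apply: commuteX; apply: commute_sym.
  rewrite zE; apply: commuteX; exact: commute_sym.
have -> : b ^+ 4 = b ^+ 2 ^+ 2 by rewrite -expgM.
rewrite conjXg b2 expgMn // expgMn // z2 mulg1 expgMn; last exact: commute_sym.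
by rewrite !expgVn -!expgM.
Qed.

(** Substituting [a^-1 = b * a * b] in [Rab] shows that [a] conjugates [b ^+ 2] to [b ^+ 2 * y],
    whose square is [b ^+ 4]. *)
Let b4_a : commute (b ^+ 4) a.
Proof.
have aV : a^-1 = b * a * b.
  by apply: (mulgI a); rewrite mulgV -ab2 expgS expg1 !mulgA.
have yb : commute y b by case: y1z => ->; [apply: commute_sym; apply: commute1|].
have y2 : y ^+ 2 = 1 by case: y1z => -> //; rewrite expg1n.
have E : (b ^+ 2) ^ a = b ^+ 2 * y.
  apply: (mulgI a); rewrite -conjgC; apply: (mulIg b).
  transitivity (b * a^-1); first by rewrite aV !mulgA.
  by rewrite Rab -!mulgA yb.
rewrite /commute conjgC; congr (_ * _).
rewrite (_ : 4 = 2 * 2)%N // expgM conjXg E expgMn ?y2 ?mulg1 //.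
by apply: commute_sym; apply: commuteX.
Qed.

Let g_a : commute (c ^+ 8 * q ^+ 2) a.
Proof.
have t2 : (b * c)^-1 = b * c.
  by apply: (mulgI (b * c)); rewrite mulgV -bc2 expgS expg1.
have aJ : a ^ (b * c)^-1 = a^-1.
  rewrite t2 conjgE t2; apply: (mulgI a).
  by rewrite mulgV -abc2 expgS expg1 !mulgA.
have gV : c ^- 8 * q ^+ 2 = (c ^+ 8 * q ^+ 2)^-1.
  by rewrite (invMg (c ^+ 8)) qVV q2E; apply: commute_sym; apply: commuteV; apply: commuteX2.
have bJ : (b ^+ 4) ^ (b * c)^-1 = b ^- 4 * (c ^+ 8 * q ^+ 2)^-1.
  rewrite invMg conjgM b4_conj_c gV.
  move: (c ^+ 8 * q ^+ 2) g_b => g gb; rewrite conjgE invgK.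
  have h : commute b (b ^- 4 * g^-1).
    apply: commuteM; first by apply: commuteV; apply: commuteX.
    by apply: commuteV; apply: commute_sym.
  by rewrite mulgA h mulgK.
(* Conjugating [b4_a] by the involution [b * c] makes [a^-1] commute with [b ^- 4 * g^-1], where
   [g = c ^+ 8 * q ^+ 2]; as it also commutes with [b ^+ 4], it commutes with [g]. *)
have := congr1 (fun x => x ^ (b * c)^-1) b4_a; rewrite /= (conjMg (b ^+ 4)) (conjMg a) aJ bJ.
move: (c ^+ 8 * q ^+ 2) => g E.
have h1 : commute a^-1 (b ^+ 4 * (b ^- 4 * g^-1)).
  apply: commuteM; last exact: (esym E).
  by apply: commute_sym; apply: commuteV.
move: h1; rewrite mulKVg => /commute_sym/commuteV; rewrite invgK.
by move/commute_sym/commuteV; rewrite invgK => /commute_sym.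
Qed.

Lemma collapse_expg16 : c ^+ 16 = 1.
Proof.
have g_ab : commute (c ^+ 8 * q ^+ 2) (a * b) by apply: commuteM.
have cJ : c ^ (a * b) = c^-1.
  apply: (mulIg c); rewrite mulVg conjgE.
  have -> : (a * b)^-1 = a * b.
    by apply: (mulgI (a * b)); rewrite mulgV -ab2 expgS expg1.
  by rewrite -abc2 expgS expg1 !mulgA.
have gV : c ^+ 8 * q ^+ 2 = (c ^+ 8 * q ^+ 2)^-1.
  have E : (c ^+ 8 * q ^+ 2) ^ (a * b) = c ^+ 8 * q ^+ 2 by rewrite conjgE g_ab mulKg.
  (* By [q2E] the element is a power of [c], so [a * b] inverts it as well as centralizing it. *)
  by rewrite -[LHS]E q2E -expgD conjXg cJ expgVn.
have : (c ^+ 8 * q ^+ 2) ^+ 2 = 1 by rewrite expgS expg1 {1}gV mulVg.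
rewrite expgMn; first by rewrite -!expgM q4 mulg1.
by rewrite q2E; apply: commuteX2.
Qed.

End Collapse.

Local Open Scope ring_scope.

(** * Integer exponents as differences of natural numbers *)

Section IntegerPowers.
Set Implicit Arguments.
Unset Strict Implicit.
Local Open Scope group_scope.
Variables (gT : finGroupType) (x : gT).

Lemma zexpgN (n : nat) : zexpg x (- n%:Z)%R = x ^- n.
Proof. by case: n => [|n]; rewrite ?GRing.oppr0 ?invg1 // -NegzE. Qed.

Lemma zexpgB (m n : nat) : zexpg x (m%:Z - n%:Z)%R = x ^+ m * x ^- n.
Proof.
case: (leqP n m) => [nm|/ltnW mn].
  by rewrite subzn // -{2}(subnK nm) expgD mulgK.
rewrite -GRing.opprB subzn // zexpgN; apply: (mulIg (x ^+ n)).
by rewrite mulgKV -{2}(subnK mn) expgD mulKg.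
Qed.

End IntegerPowers.

(** * From the polytope to the group relations *)

Theorem theorem5p13 (beta : nat) (e1 e2 : int) :
  (5 <= beta)%N -> (e1 = 0 \/ e1 = 1) -> (e2 = 1 \/ e2 = -1) ->
  forall (T : finType) (le : rel T) (rk : T -> nat),
  polytope4 le rk -> chiral le rk ->
  tight_of_type le rk (2 ^ (beta - 2))%N (2 ^ (beta - 1))%N (2 ^ beta)%N ->
  forall (Phi : {ffun 'I_6 -> T}) (s1 s2 s3 : {perm T}),
  is_flag le rk Phi ->
  std_gen le rk Phi 1 s1 -> std_gen le rk Phi 2 s2 -> std_gen le rk Phi 3 s3 ->
  ~ [/\ (s2 * s1^-1)%g = (s1 * zexpg s2 (3 - e1 * 2 ^+ (beta - 2)%N))%g,
        (s3^-1 * s2)%g =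
          (zexpg s2 (-1 + 2 ^+ (beta - 2)%N) * zexpg s3 (-3 + e2 * 2 ^+ (beta - 2)%N))%g &
        (s3 * s2^-1)%g =
          (zexpg s2 (1 + 2 ^+ (beta - 2)%N) * zexpg s3 (3 + e2 * 2 ^+ (beta - 2)%N))%g].
Proof.
move=> b5 e1E e2E T le rk P chi [typ _] Phi a b c hPhi ra rb rc [].
pose m := (2 ^ (beta - 5))%N.
have hE : (2 ^ (beta - 2) = 8 * m)%N.
  by rewrite /m -[8%N]/(2 ^ 3)%N -expnD; congr (2 ^ _)%N; lia.
have -> : 2 ^+ (beta - 2)%N = (8 * m)%N%:Z :> int by rewrite -hE -GRing.natrX natz.
(* The products [a * b], [b * c] and [a * b * c] change the base flag at indices 3 and 1, 4 and 2, 4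
   and 1: never consecutive, so all three square to 1. *)
have ab2 := rot_at_sq P hPhi (isT : 2 < 3)%N (rot_at_mul P hPhi ra rb).
have rbc := rot_at_mul P hPhi rb rc.
have bc2 := rot_at_sq P hPhi (isT : 3 < 4)%N rbc.
have := rot_at_sq P hPhi (isT : 2 < 4)%N (rot_at_mul P hPhi ra rbc).
rewrite mulgA => abc2.
have Phi_le k l : (k <= l < 6)%N -> le (face Phi k) (face Phi l).
  case/andP=> kl l6; case/andP: hPhi => _ /forallP/(_ (inord k))/forallP/(_ (inord l)).
  by rewrite !inordK ?kl //; lia.
have secb : sec_count le rk (face Phi 1) (face Phi 4) = (2 ^ (beta - 1))%N.
  by have [_ + _] := typ _ _ (Phi_le 1%N 4%N isT); apply; rewrite (flag_rk P).
have secc : sec_count le rk (face Phi 2) (face Phi 5) = (2 ^ beta)%N.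
  by have [_ _] := typ _ _ (Phi_le 2%N 5%N isT); apply; rewrite (flag_rk P).
have bo := rot_order P hPhi (isT : 0 < 2)%N isT rb chi.
have co := rot_order P hPhi (isT : 0 < 3)%N isT rc chi.
have ordc := section_le_order P hPhi (isT : 0 < 3)%N isT rc.
rewrite /= secb in bo; rewrite /= secc in co; rewrite /= secc in ordc.
have z2 : ((b ^+ (8 * m)) ^+ 2 = 1)%g.
  by rewrite -expgM -hE -expnSr; move: bo; congr (_ ^+ (2 ^ _) = _)%g; lia.
have c4 : ((c ^+ (8 * m)) ^+ 4 = 1)%g.
  rewrite -expgM -hE -[4%N]/(2 ^ 2)%N -expnD; move: co.
  by congr (_ ^+ (2 ^ _) = _)%g; lia.
have zV : (b ^- (8 * m) = b ^+ (8 * m))%g.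
  by apply: (mulgI (b ^+ (8 * m))%g); rewrite mulgV -z2 expgS expg1.
(* The sums are reordered so that the exponents become differences to which [zexpgB] applies. *)
rewrite [-1 + _]GRing.addrC [-3 + _]GRing.addrC (zexpgB b _ 1).
move=> R1 R2 R3.
have [y yE R1'] : exists2 y, y = 1%g \/ y = (b ^+ (8 * m))%g &
    (b * a^-1 = a * (b ^+ 3 * y))%g.
  case: e1E R1 => ->; rewrite ?GRing.mul0r ?GRing.mul1r => ->.
    by exists 1%g; [left | rewrite mulg1].
  by exists (b ^+ (8 * m))%g; [right | rewrite zexpgB zV].
have [q [qE q3 q3']] : exists q,
    [/\ q = (c ^+ (8 * m))%g \/ q = (c ^- (8 * m))%g,
        zexpg c (e2 * (8 * m)%N%:Z - 3) = (c ^- 3 * q)%g &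
        zexpg c (3 + e2 * (8 * m)%N%:Z) = (c ^+ 3 * q)%g].
  case: e2E => ->; rewrite ?GRing.mul1r ?GRing.mulN1r.
    exists (c ^+ (8 * m))%g; split; [by left | | exact: expgD].
    by rewrite zexpgB; apply/commute_sym/commuteX/commute_sym/commuteV/commuteX.
  exists (c ^- (8 * m))%g; split; [by right | | exact: zexpgB].
  by rewrite -GRing.opprD zexpgN expgD invMg.
(* The order of [c] is at least the number [2 ^ beta] of faces of its section, hence at least 32, so
   it cannot divide 16. *)
suff c16 : (c ^+ 16 = 1)%g.
  have /dvdn_leq : (#[c]%g %| 16)%N by rewrite order_dvdn c16.
  have := leq_pexp2l (isT : 0 < 2)%N b5.
  by move: ordc; lia.
apply: (@collapse_expg16 _ a b c y (b ^+ (8 * m))%g q m) => //.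
- by case: qE => ->; rewrite ?expgVn c4 ?invg1.
- rewrite R2 q3; congr (_ * _)%g.
  by apply: commuteV; apply/commute_sym/commuteX.
- by rewrite R3 q3'; congr (_ * _)%g; rewrite -PoszD /= expgD.
Qed.
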